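(* Let $\gamma>0$ be a constant, and assume that the stagewise algorithm, run for $K$ stages, returns a (random) solution $x_\tau$ such that $\mathbb{E}[\|G_\gamma(x_\tau)\|^2]\le O(1/K)$. (1) If $g+r$ is differentiable and has $(L,\nu)$-H\''older continuous gradient with $\nu\in(0,1]$, then $$\mathbb{E}\big[\mathrm{dist}\big(\partial h(x_\tau),\nabla g(x_\tau)+\nabla r(x_\tau)\big)\big]\le O\Big(\frac{1}{K^{\nu/2}}+\frac1{K^{1/2}}\Big).$$ (2) If $h$ is differentiable and has $(L,\nu)$-H\''older continuous gradient with $\nu\in(0,1]$, then, with $z_\tau=P_\gamma(x_\tau)$, $$\mathbb{E}[\|x_\tau-z_\tau\|]\le O\Big(\frac{1}{K^{1/2}}\Big),\qquad\mathbb{E}\big[\mathrm{dist}\big(\nabla h(z_\tau),\partial g(z_\tau)+\partial r(z_\tau)\big)\big]\le O\Big(\frac{1}{K^{\nu/2}}+\frac1{K^{1/2}}\Big).$$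
   Context: Problem: $\min_{x\in\mathbb{R}^d}F(x):=g(x)+r(x)-h(x)$, where $g,h:\mathbb{R}^d\to\mathbb{R}$ are lower-semicontinuous convex and $r:\mathbb{R}^d\to\mathbb{R}\cup\{+\infty\}$ is proper lower-semicontinuous convex. $\|\cdot\|$ is the Euclidean norm and $\mathrm{dist}(S_1,S_2)$ is the distance between two sets. A differentiable $f$ has $(L,\nu)$-H\''older continuous gradient if $\|\nabla f(x)-\nabla f(y)\|\le L\|x-y\|^\nu$ for all $x,y$. When $\partial h(z)$ is used as a vector (in the definition below) it denotes a fixed chosen subgradient of $h$ at $z$; inside $\mathrm{dist}$ it is the subdifferential. For $\gamma>0$, $z\in\mathbb{R}^d$: $$F^{\gamma}_{z}(x)=g(x)+r(x)-\big(h(z)+\partial h(z)^{\top}(x-z)\big)+\tfrac{\gamma}{2}\|x-z\|^2,$$ $P_\gamma(z)=\arg\min_xF^\gamma_z(x)$, $G_\gamma(z)=\gamma(z-P_\gamma(z))$. Stagewise algorithm: $x_1\in\mathrm{dom}(r)$; for $k=1,\dots,K$, $x_{k+1}$ is the output of a stochastic algorithm applied to $F^\gamma_{x_k}$; the returned point is $x_\tau$ for a random index $\tau\in\{1,\dots,K\}$. The $O(\cdot)$ constants do not depend on $K$. *)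

(* Defs.v *)
From HB Require Import structures.
From mathcomp Require Import all_boot all_order all_algebra.
From mathcomp Require Import all_classical all_reals all_analysis.

Set Implicit Arguments.
Unset Strict Implicit.
Unset Printing Implicit Defensive.

Import Order.TTheory GRing.Theory Num.Theory.
Import numFieldNormedType.Exports.

Local Open Scope classical_set_scope.
Local Open Scope ring_scope.

Section Euclidean.
Context {R : realType} {d : nat}.
Implicit Types (x y z u v : 'rV[R]_d) (S T : set 'rV[R]_d).

(* The library norm `|x| on 'rV[R]_d is the max norm, which induces the same
   topology and the same notion of differentiability. *)
Definition dot u v : R := \sum_i u 0 i * v 0 i.
Definition enorm x : R := Num.sqrt (dot x x).

(* The infimum is taken in \bar R, so that the distance to an empty set is
   +oo. *)
Definition set_dist S T : \bar R :=
  ereal_inf [set (enorm (a - b))%:E | a in S & b in T].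

Definition minkowski_sum S T : set 'rV[R]_d := [set a + b | a in S & b in T].

Definition gradient (f : 'rV[R]_d -> R) x : 'rV[R]_d :=
  \row_i 'D_(delta_mx 0 i) f x.

Definition hoelder_gradient (L nu : R) (f : 'rV[R]_d -> R) :=
  (forall x, differentiable f x) /\
  forall x y,
    enorm (gradient f x - gradient f y) <= L * enorm (x - y) `^ nu.

Definition dom (f : 'rV[R]_d -> \bar R) : set 'rV[R]_d :=
  [set x | (f x < +oo)%E].

Definition proper_function (f : 'rV[R]_d -> \bar R) :=
  (forall x, (-oo < f x)%E) /\ dom f !=set0.

(* Meant for functions that never take the value -oo; recall that
   0 * +oo = 0 in \bar R. *)
Definition convex_ereal (f : 'rV[R]_d -> \bar R) :=
  forall (t : R) x y, 0 <= t <= 1 ->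
    (f (t *: x + (1 - t) *: y)%R <= t%:E * f x + (1 - t)%:E * f y)%E.

(* Empty at the points outside the domain of a proper f. *)
Definition subdifferential (f : 'rV[R]_d -> \bar R) x : set 'rV[R]_d :=
  [set v | forall y, (f x + (dot v (y - x)%R)%:E <= f y)%E].

End Euclidean.

Section ProximalLinearization.
Context {R : realType} {d : nat}.
Variables (g : 'rV[R]_d -> R) (r : 'rV[R]_d -> \bar R) (h : 'rV[R]_d -> R).
(* dh z is the chosen subgradient of h at z. *)
Variables (dh : 'rV[R]_d -> 'rV[R]_d) (gamma : R).
Implicit Types x z : 'rV[R]_d.

Definition Fgamma z x : \bar R :=
  ((g x)%:E + r x - (h z + dot (dh z) (x - z))%R%:E
   + (gamma / 2 * enorm (x - z) ^+ 2)%R%:E)%E.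

(* The minimizer exists and is unique by strong convexity; the default value 0
   only serves to make the selection total. *)
Definition Pgamma z : 'rV[R]_d :=
  xget 0 [set p | forall x, (Fgamma z p <= Fgamma z x)%E].

Definition Ggamma z : 'rV[R]_d := gamma *: (z - Pgamma z).

End ProximalLinearization.

Definition random_vector {R : realType} {n : nat} {d : measure_display}
    {Omega : measurableType d} (X : Omega -> 'rV[R]_n) :=
  forall i, measurable_fun setT (fun w => X w 0 i).

(* x k is the iterate x_k, with k = 1, ..., K.+1 as the relevant range, and
   alg k maps an objective function and a random outcome to the output of the
   stochastic algorithm that is used at stage k. *)
Definition stagewise_run {R : realType} {n : nat} {d : measure_display}
    {Omega : measurableType d} (r : 'rV[R]_n -> \bar R)
    (F : 'rV[R]_n -> 'rV[R]_n -> \bar R) (K : nat)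
    (alg : nat -> ('rV[R]_n -> \bar R) -> Omega -> 'rV[R]_n)
    (x : nat -> Omega -> 'rV[R]_n) (tau : Omega -> nat) :=
  [/\ forall w, dom r (x 1%N w),
      forall k w, (1 <= k <= K)%N -> x k.+1 w = alg k (F (x k w)) w,
      forall k, (1 <= k <= K.+1)%N -> random_vector (x k),
      measurable_fun setT tau &
      forall w, (1 <= tau w <= K)%N].

(* a K = O(b K), with a constant independent of K >= 1. *)
Definition bigO_stages {R : realType} (a : nat -> \bar R) (b : nat -> R) :=
  exists C : R, forall K, (0 < K)%N -> (a K <= (C * b K)%:E)%E.

(* Main.v *)
(* With p = P_gamma(z), completing the square makes p a proximal point of g + r,
   so that dh(z) + gamma (z - p) is a subgradient of g + r at p. If g + r or h
   has a Hoelder gradient, replacing p by z (respectively z by p) in this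
   inclusion costs L |z - p|^nu, and both distances of the theorem are at most
   L |z - p|^nu + |G_gamma(z)|, where |z - p| = |G_gamma(z)| / gamma. The
   pointwise bound s^nu <= K^(-nu/2) (1 + K s^2) turns E[s^2] = O(1/K) into
   E[s^nu] = O(K^(-nu/2)). For part (2), the sum rule for subdifferentials
   splits the subgradient of g + r; it comes from a finite-dimensional
   Hahn-Banach argument applied to v |-> inf_y (g(y + v) + r(y)), tilted. *)

Require Import Defs.
From HB Require Import structures.
From mathcomp Require Import all_boot all_order all_algebra.
From mathcomp Require Import all_classical all_reals all_analysis.
From mathcomp Require Import measurable_realfun ring lra.

Set Implicit Arguments.
Unset Strict Implicit.
Unset Printing Implicit Defensive.

Import Order.TTheory GRing.Theory Num.Theory.
Import numFieldNormedType.Exports.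

Local Open Scope classical_set_scope.
Local Open Scope ring_scope.

(** * Inner product and Euclidean norm on row vectors *)

Section EuclideanGeometry.
Context {R : realType} {n : nat}.
Implicit Types (x y u v w : 'rV[R]_n) (a : R).

Lemma dotC u v : dot u v = dot v u.
Proof. by apply: eq_bigr => i _; rewrite mulrC. Qed.

Lemma dotDr u v w : dot u (v + w) = dot u v + dot u w.
Proof. by rewrite -big_split; apply: eq_bigr => i _; rewrite mxE mulrDr. Qed.

Lemma dotDl u v w : dot (u + v) w = dot u w + dot v w.
Proof. by rewrite dotC dotDr !(dotC w). Qed.

Lemma dotZr a u v : dot u (a *: v) = a * dot u v.
Proof. by rewrite mulr_sumr; apply: eq_bigr => i _; rewrite mxE mulrCA. Qed.

Lemma dotZl a u v : dot (a *: u) v = a * dot u v.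
Proof. by rewrite dotC dotZr dotC. Qed.

Lemma dotNr u v : dot u (- v) = - dot u v.
Proof. by rewrite -scaleN1r dotZr mulN1r. Qed.

Lemma dotNl u v : dot (- u) v = - dot u v.
Proof. by rewrite dotC dotNr dotC. Qed.

Lemma dot0r u : dot u 0 = 0.
Proof. by rewrite -(scale0r 0) dotZr mul0r. Qed.

Lemma dot_delta u (i : 'I_n) : dot u (delta_mx 0 i) = u 0 i.
Proof.
rewrite /dot (bigD1 i)//= mxE !eqxx mulr1 big1 ?addr0// => j ji.
by rewrite mxE eqxx (negbTE ji) mulr0.
Qed.

Lemma dot_ge0 u : 0 <= dot u u.
Proof. by apply: sumr_ge0 => i _; rewrite -expr2 sqr_ge0. Qed.

Lemma enorm_ge0 u : 0 <= enorm u. Proof. exact: sqrtr_ge0. Qed.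

Lemma enorm_sqr u : enorm u ^+ 2 = dot u u.
Proof. by rewrite sqr_sqrtr// dot_ge0. Qed.

Lemma enormN u : enorm (- u) = enorm u.
Proof. by rewrite /enorm dotNl dotNr opprK. Qed.

Lemma enormB u v : enorm (u - v) = enorm (v - u).
Proof. by rewrite -enormN opprB. Qed.

Lemma enormZ a u : enorm (a *: u) = `|a| * enorm u.
Proof.
by rewrite /enorm dotZl dotZr mulrA -expr2 sqrtrM ?sqr_ge0// sqrtr_sqr.
Qed.

Lemma enormDsqr u v :
  enorm (u + v) ^+ 2 = enorm u ^+ 2 + 2 * dot u v + enorm v ^+ 2.
Proof. by rewrite !enorm_sqr dotDl !dotDr (dotC v u); ring. Qed.

Lemma coord_le_enorm u i : `|u 0 i| <= enorm u.
Proof.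
rewrite -ler_sqr ?nnegrE ?enorm_ge0// enorm_sqr real_normK ?num_real//.
rewrite /dot (bigD1 i)//= -expr2 lerDl.
by apply: sumr_ge0 => j _; rewrite -expr2 sqr_ge0.
Qed.

(** Expand the nonnegative square of [enorm v *: u - enorm u *: v] and divide by both norms; a
    vector of norm zero vanishes and is treated apart. *)
Lemma Cauchy_Schwarz u v : dot u v <= enorm u * enorm v.
Proof.
have [v0|v_neq0] := eqVneq (enorm v) 0.
  suff -> : v = 0 by rewrite dot0r mulr_ge0 ?enorm_ge0.
  apply/rowP => i; apply/eqP; rewrite mxE -normr_eq0 eq_le normr_ge0.
  by rewrite -v0 coord_le_enorm.
have v_gt0 : 0 < enorm v by rewrite lt0r v_neq0 enorm_ge0.
have /(_ (enorm v *: u - enorm u *: v)) := dot_ge0.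
have := enorm_sqr u; have := enorm_sqr v.
rewrite !(dotDl, dotDr, dotNl, dotNr, dotZl, dotZr) (dotC v u) => <- <- H.
have [u0|u_neq0] := eqVneq (enorm u) 0.
  suff -> : u = 0 by rewrite dotC dot0r mulr_ge0 ?enorm_ge0.
  apply/rowP => i; apply/eqP; rewrite mxE -normr_eq0 eq_le normr_ge0.
  by rewrite -u0 coord_le_enorm.
have u_gt0 : 0 < enorm u by rewrite lt0r u_neq0 enorm_ge0.
by rewrite -(ler_pM2l u_gt0) -(ler_pM2l v_gt0); lra.
Qed.

Lemma ler_enormD u v : enorm (u + v) <= enorm u + enorm v.
Proof.
rewrite -ler_sqr ?nnegrE ?addr_ge0 ?enorm_ge0// enormDsqr.
by have := Cauchy_Schwarz u v; lra.
Qed.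

Lemma continuous_enorm_sqr x : continuous (fun y => enorm (y - x) ^+ 2).
Proof.
have -> : (fun y => enorm (y - x) ^+ 2) =
    (fun y => \sum_(i < n) (y 0 i - x 0 i) * (y 0 i - x 0 i)).
  by apply/funext => y; rewrite enorm_sqr; apply: eq_bigr => i _; rewrite !mxE.
apply: continuous_big => [|i _ y]; first exact: add_continuous.
have yi : z 0 i @[z --> y] --> y 0 i by exact: coord_continuous.
have yx : z 0 i - x 0 i @[z --> y] --> y 0 i - x 0 i.
  by apply: cvgB yi _; exact: cvg_cst.
exact: (cvgM yx yx).
Qed.

End EuclideanGeometry.

(** * A finite-dimensional Hahn-Banach argument *)

Section HahnBanach.
Context {R : realType} {n : nat}.
Implicit Types (u v w : 'rV[R]_n).

(* [C] plays the role of the epigraph of a finite convex function that is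
   nonnegative at [0]; the linear minorant is built coordinate by coordinate. *)
Lemma convex_minorant (C : 'rV[R]_n -> R -> Prop) :
  (forall t v w a b, 0 < t < 1 -> C v a -> C w b ->
     C (t *: v + (1 - t) *: w) (t * a + (1 - t) * b)) ->
  (forall v, exists a, C v a) ->
  (forall a, C 0 a -> 0 <= a) ->
  exists u, forall v a, C v a -> dot u v <= a.
Proof.
move=> C_convex C_total C0.
suff H k : (k <= n)%N -> exists u, forall v a,
    (forall i : 'I_n, (k <= i)%N -> v 0 i = 0) -> C v a -> dot u v <= a.
  have [u Hu] := H n (leqnn n); exists u => v a; apply: Hu => i.
  by rewrite leqNgt ltn_ord.
elim: k => [_|k IH kn].
  exists 0 => v a v0; have -> : v = 0 by apply/rowP => i; rewrite v0// mxE.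
  by rewrite dot0r; exact: C0.
have [u Hu] := IH (ltnW kn).
pose i0 := Ordinal kn; pose e : 'rV[R]_n := delta_mx 0 i0.
pose supp v := forall i : 'I_n, (k <= i)%N -> v 0 i = 0.
(* The points with a negative component along [e] force these lower bounds on the new coordinate of
   the minorant. *)
pose S := [set y | exists v a s,
  [/\ supp v, 0 < s, C (v - s *: e) a & y = (dot u v - a) / s]].
(* The weights [t / (s + t)] and [s / (s + t)] cancel the multiples of [e], so the induction
   hypothesis applies to the combination: every lower bound is at most every upper bound. *)
have key v a s w b t : supp v -> supp w -> 0 < s -> 0 < t ->
    C (v - s *: e) a -> C (w + t *: e) b ->
    (dot u v - a) / s <= (b - dot u w) / t.
  move=> sv sw s0 t0 Cv Cw; have st0 : 0 < s + t by rewrite addr_gt0.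
  have ts01 : 0 < t / (s + t) < 1.
    by rewrite divr_gt0//= ltr_pdivrMr// mul1r ltrDr.
  have := C_convex _ _ _ _ _ ts01 Cv Cw.
  have ts1 : 1 - t / (s + t) = s / (s + t) by field; rewrite gt_eqF.
  rewrite ts1 [X in C X](_ : _ =
      (t / (s + t)) *: v + (s / (s + t)) *: w); last first.
    by apply/rowP => i; rewrite !mxE; field; rewrite gt_eqF.
  have svw : supp ((t / (s + t)) *: v + (s / (s + t)) *: w).
    by move=> i ki; rewrite !mxE sv// sw// !mulr0 addr0.
  move=> /(Hu _ _ svw); rewrite dotDr !dotZr.
  move=> Huvw; have {Huvw} : t * dot u v + s * dot u w <= t * a + s * b.
    move: Huvw; rewrite -(ler_pM2r st0) -!mulrA.
    congr (is_true (_ <= _)); field; exact: lt0r_neq0.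
  by rewrite ler_pdivrMr// mulrAC ler_pdivlMr//; lra.
have supp0 : supp 0 by move=> i _; rewrite mxE.
have S_neq0 : S !=set0.
  by have [a Ca] := C_total (0 - 1 *: e); exists ((dot u 0 - a) / 1), 0, a, 1.
have S_ub w b t : supp w -> 0 < t -> C (w + t *: e) b ->
    ubound S ((b - dot u w) / t).
  by move=> sw t0 Cw _ [v [a [s [sv s0 Cv ->]]]]; exact: key.
have S_sup : has_sup S.
  split=> //; have [b Cb] := C_total (0 + 1 *: e).
  by exists ((b - dot u 0) / 1); exact: S_ub.
(* Coordinate [i0] of [u] is replaced by [sup S]. For [v] with negative [s] this works since [sup S]
   bounds [S], for positive [s] since it is the least bound. *)
exists (u + (sup S - u 0 i0) *: e) => v a sv Cv.
pose s := v 0 i0; pose w := v - s *: e.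
have sw : supp w.
  move=> i; rewrite leq_eqVlt => /orP[/eqP ki|ki].
    have -> : i = i0 by exact: val_inj.
    by rewrite !mxE !eqxx mulr1 subrr.
  rewrite !mxE sv//= (_ : (i == i0) = false) ?mulr0 ?subr0//.
  by apply/eqP => ii0; move: ki; rewrite ii0 ltnn.
have vE : v = w + s *: e by rewrite subrK.
have -> : dot (u + (sup S - u 0 i0) *: e) v = dot u w + sup S * s.
  by rewrite dotDl dotZl (dotC e) dot_delta dotDr dotNr dotZr dot_delta -/s; ring.
have [s0|s0|s0] := ltgtP s 0.
- have s0' : 0 < - s by rewrite oppr_gt0.
  have Sa : S ((dot u w - a) / - s).
    by exists w, a, (- s); split=> //; rewrite scaleNr opprK -vE.
  have := ub_le_sup S_sup.2 Sa; rewrite ler_pdivrMr//; lra.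
- have : sup S <= (a - dot u w) / s.
    by apply: ge_sup S_neq0 _; apply: S_ub; rewrite -?vE.
  rewrite ler_pdivlMr//; lra.
- rewrite s0 mulr0 addr0; apply: Hu => //; rewrite /w s0 scale0r subr0.
  exact: Cv.
Qed.

End HahnBanach.

(** * Lower semicontinuity and attainment of minima *)

Lemma lte_EFin_between {R : realType} (x y : \bar R) :
  (x < y)%E -> exists2 a : R, (x < a%:E)%E & (a%:E < y)%E.
Proof.
case: x y => [r||] [s||] //.
- by rewrite lte_fin => rs; exists ((r + s) / 2); rewrite lte_fin; lra.
- by move=> _; exists (r + 1); rewrite ?ltry// lte_fin ltrDl.
- by move=> _; exists (s - 1); rewrite ?ltNyr// lte_fin gtrDl oppr_lt0.
- by move=> _; exists 0; rewrite ?ltNyr ?ltry.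
Qed.

(** A real [b] strictly between [a - f x] and [g x] splits the level [a] into [a - b] for [f] and
    [b] for [g]. *)
Lemma lower_semicontinuousD {R : realType} {X : topologicalType} (f : X -> R)
    (g : X -> \bar R) :
  lower_semicontinuous (EFin \o f) -> lower_semicontinuous g ->
  lower_semicontinuous (fun x => (f x)%:E + g x)%E.
Proof.
move=> f_lsc g_lsc x a; rewrite -lteBlDl// -EFinB => agx.
have [b ab bgx] : exists2 b, a - f x < b & (b%:E < g x)%E.
  by have [b] := lte_EFin_between agx; rewrite lte_fin; exists b.
have [V Vx Vg] := g_lsc x b bgx.
have [|W Wx Wf] := f_lsc x (a - b); first by rewrite lte_fin; lra.
exists (V `&` W); first exact: filterI.
move=> y [/Vg + /Wf]; rewrite /= lte_fin => bgy aby.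
rewrite -lteBlDl// -EFinB; apply: le_lt_trans bgy.
by rewrite lee_fin; lra.
Qed.

Lemma continuous_lower_semicontinuous {R : realType} {X : topologicalType}
    (f : X -> R) : continuous f -> lower_semicontinuous (EFin \o f).
Proof.
move=> f_cont x a; rewrite lte_fin => afx.
by exists [set y | a < f y] => //; exact: (cvgr_gt _ (f_cont x)).
Qed.

(** The sublevel sets of [f] in [K] at real levels above the infimum generate a proper filter. A
    cluster point [p] is a minimizer: a level strictly below [f p] would have a sublevel set that
    misses a neighborhood of [p]. *)
Lemma lower_semicontinuous_min {R : realType} {X : topologicalType}
    (f : X -> \bar R) (K : set X) :
  lower_semicontinuous f -> compact K -> K !=set0 ->
  exists2 p, K p & forall x, K x -> (f p <= f x)%E.
Proof.
move=> f_lsc K_compact [x0 Kx0]; pose m := ereal_inf (f @` K).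
have m_le x : K x -> (m <= f x)%E by move=> Kx; apply: ereal_inf_lbound; exists x.
(* If the infimum is [+oo], any point of [K] will do; otherwise there are real levels above it and
   the filter base is inhabited. *)
have [m_oo|m_fin] := eqVneq m +oo%E.
  by exists x0 => // x /m_le; rewrite m_oo leye_eq => /eqP ->; exact: leey.
have [a0 ma0 _] : exists2 a, (m < a%:E)%E & (a%:E < +oo)%E.
  by apply: lte_EFin_between; rewrite ltey.
pose F := filter_from [set a : R | (m < a%:E)%E]
  (fun a => K `&` [set x | (f x <= a%:E)%E]).
have F_filter : ProperFilter F.
  apply: filter_from_proper => [|a /= ma]; last first.
    have [_ [x Kx <-] fxa] := ereal_inf_lt ma.
    by exists x; split=> //; exact: ltW.
  apply: filter_from_filter => [|a b /= ma mb].
    by exists a0.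
  exists (Num.min a b) => [/=|x /= [Kx]].
    by rewrite EFin_min lt_min ma.
  by rewrite EFin_min le_min => /andP[].
have FK : F K by exists a0 => // x [].
have [p [Kp p_cluster]] := K_compact F F_filter FK.
exists p => // x /m_le; apply: le_trans; rewrite leNgt; apply/negP => mfp.
have [a ma afp] := lte_EFin_between mfp.
have [V Vp Va] := f_lsc _ _ afp.
have [] := p_cluster (K `&` [set x | (f x <= a%:E)%E]) V; first by exists a.
  by [].
by move=> y [[_ /= fya] /Va]; rewrite ltNge fya.
Qed.

(** * Subdifferential calculus and proximal points *)

Section ConvexAnalysis.
Context {R : realType} {n : nat}.
Implicit Types (x y z u v w s : 'rV[R]_n) (t a b : R) (f r : 'rV[R]_n -> \bar R).

(* Quantifying over real upper bounds of [f x] and [f y] avoids the products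
   [0 * +oo] of [convex_ereal]. *)
Definition epi_convex f := forall t x y a b, 0 <= t <= 1 ->
  (f x <= a%:E)%E -> (f y <= b%:E)%E ->
  (f (t *: x + (1 - t) *: y)%R <= (t * a + (1 - t) * b)%:E)%E.

Lemma convex_ereal_epi f : convex_ereal f -> epi_convex f.
Proof.
move=> f_convex t x y a b t01 fxa fyb.
apply: (le_trans (f_convex t x y t01)); rewrite [leRHS]EFinD !EFinM.
by apply: leeD; apply: lee_wpmul2l => //; rewrite lee_fin; lra.
Qed.

Lemma convex_function_epi (g : 'rV[R]_n -> R) :
  convex_function setT g -> epi_convex (EFin \o g).
Proof.
move=> g_convex t x y a b /andP[t0 t1]; rewrite /= !lee_fin => ga gb.
have gxy : g (t *: x + (1 - t) *: y) <= t * g x + (1 - t) * g y.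
  exact: g_convex (Itv01 t0 t1) x y (mem_setT _) (mem_setT _).
apply: le_trans gxy _.
by apply: lerD; apply: ler_wpM2l => //; lra.
Qed.

Lemma epi_convexD (g : 'rV[R]_n -> R) r :
  epi_convex (EFin \o g) -> epi_convex r ->
  epi_convex (fun x => (g x)%:E + r x)%E.
Proof.
move=> g_convex r_convex t x y a b t01; rewrite -!leeBrDl// -!EFinB => ra rb.
apply: (le_trans (r_convex t x y _ _ t01 ra rb)); rewrite lee_fin.
have := g_convex t x y _ _ t01 (lexx _) (lexx _); rewrite /= lee_fin; lra.
Qed.

Lemma subgradient_sum (g : 'rV[R]_n -> R) r x s :
  epi_convex (EFin \o g) -> epi_convex r -> proper_function r ->
  subdifferential (fun y => (g y)%:E + r y)%E x s ->
  minkowski_sum (subdifferential (EFin \o g) x) (subdifferential r x) s.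
Proof.
move=> g_convex r_convex [r_ninfty [y0 ry0]] xs.
(* Were [r x] infinite, the subgradient inequality would fail at the domain point [y0]. *)
have rx_fin : r x \is a fin_num.
  rewrite fin_numE gt_eqF//=; apply/eqP => rxoo.
  have := xs y0; rewrite rxoo/= leye_eq => /eqP.
  by move: ry0 (r_ninfty y0); rewrite /dom /=; case: (r y0).
have {}xs : forall y b, (r y <= b%:E)%E ->
    g x + fine (r x) + dot s (y - x) <= g y + b.
  move=> y b ryb; rewrite -lee_fin !EFinD fineK//; have /= := xs y.
  by move=> /le_trans; apply; rewrite leeD2l.
(* The epigraph of [v |-> inf_y (g (y + v) - <s, y + v> + r y)], up to an
   additive constant. *)
pose C v a := exists y b, (r y <= b%:E)%E /\
  g (y + v) - g x - dot s (y + v - x) + (b - fine (r x)) <= a.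
have [u Hu] : exists u, forall v a, C v a -> dot u v <= a.
  apply: convex_minorant => [t v w a b /andP[t0 t1]|v|a [y [b []]]].
  - move=> [y [c [ryc Ha]]] [y' [c' [ryc' Hb]]].
    have t01 : 0 <= t <= 1 by rewrite !ltW.
    exists (t *: y + (1 - t) *: y'), (t * c + (1 - t) * c').
    split; first exact: r_convex.
    have := g_convex t (y + v) (y' + w) _ _ t01 (lexx _) (lexx _).
    rewrite /= lee_fin.
    have -> : t *: (y + v) + (1 - t) *: (y' + w) =
        t *: y + (1 - t) *: y' + (t *: v + (1 - t) *: w).
      by rewrite !scalerDr addrACA.
    set z := _ + (_ + _) => gz.
    have -> : dot s (z - x) = t * dot s (y + v - x) + (1 - t) * dot s (y' + w - x).
      rewrite /z !(dotDr, dotNr, dotZr); ring.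
    rewrite -(ler_pM2l t0) in Ha.
    rewrite -(@ler_pM2l _ (1 - t)) ?subr_gt0// in Hb.
    lra.
  - exists (g (x + v) - g x - dot s (x + v - x) + (fine (r x) - fine (r x))).
    by exists x, (fine (r x)); rewrite fineK.
  - by move=> /(xs y b); rewrite addr0; lra.
(* The subgradient splits as [(u + s) + (- u)]. Fixing the argument of [r] at [x] bounds [u + s] by
   increments of [g]; fixing that of [g] at [x] bounds [- u] by increments of [r]. *)
exists (u + s).
  move=> y; rewrite /= -EFinD lee_fin dotDl.
  have /Hu : C (y - x) (g y - g x - dot s (y - x)).
    exists x, (fine (r x)); rewrite fineK// (addrC x) subrK; split=> //; lra.
  lra.
exists (- u); last by rewrite addrAC subrr add0r.
move=> y; rewrite -[r x]fineK//; case ry: (r y) => [b||].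
- have /Hu : C (x - y) (b - fine (r x)).
    exists y, b; rewrite ry (addrC y) subrK; split=> //.
    by rewrite !subrr dot0r; lra.
  by rewrite -EFinD lee_fin dotNl -(opprB x) dotNr; lra.
- exact: leey.
- by have := r_ninfty y; rewrite ry.
Qed.

Lemma subgradient_exists (g : 'rV[R]_n -> R) x :
  epi_convex (EFin \o g) -> subdifferential (EFin \o g) x !=set0.
Proof.
move=> g_convex.
have [u Hu] : exists u, forall v a, g (x + v) - g x <= a -> dot u v <= a.
  apply: convex_minorant => [t v w a b /andP[t0 t1] Ha Hb|v|a].
  - have t01 : 0 <= t <= 1 by rewrite !ltW.
    have := g_convex t (x + v) (x + w) _ _ t01 (lexx _) (lexx _).
    have -> : t *: (x + v) + (1 - t) *: (x + w) = x + (t *: v + (1 - t) *: w).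
      by rewrite !scalerDr addrACA -scalerDl (addrC t) subrK scale1r.
    rewrite /= lee_fin.
    rewrite -(ler_pM2l t0) in Ha.
    rewrite -(@ler_pM2l _ (1 - t)) ?subr_gt0// in Hb.
    lra.
  - by exists (g (x + v) - g x).
  - by rewrite addr0 subrr.
exists u => y; rewrite /= -EFinD lee_fin.
have := Hu (y - x) _ (lexx _); rewrite (addrC x) subrK; lra.
Qed.

Definition prox_objective (c : R) f z x : \bar R :=
  (f x + (c / 2 * enorm (x - z) ^+ 2)%:E)%E.

(** The objective attains its minimum on a large ball centred at a domain point [x0], and outside
    that ball it is at least its value at [x0]. *)
Lemma prox_exists c f z : 0 < c ->
  epi_convex f -> lower_semicontinuous f -> proper_function f ->
  exists p, forall x, (prox_objective c f z p <= prox_objective c f z x)%E.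
Proof.
move=> c0 f_convex f_lsc [f_ninfty [x0 fx0]].
pose ball (rho : R) := [set x | enorm (x - x0) ^+ 2 <= rho].
have ball_compact rho : compact (ball rho).
  apply: bounded_closed_compact; last first.
    apply: (@closed_comp _ _ (fun x => enorm (x - x0) ^+ 2) [set y | y <= rho]).
      by move=> x _; exact: continuous_enorm_sqr.
    exact: closed_le.
  (* Passes from the Euclidean to the max norm, using [t <= 1 + t ^+ 2] for [t = enorm (x - x0)]. *)
  exists (enorm x0 + (1 + rho)); split; first exact: num_real.
  move=> M lM x; rewrite /ball /= => xrho.
  rewrite [leLHS]/Num.norm/= mx_normrE; apply: bigmax_le => [|[i j] _ /=].
    by have := enorm_ge0 x0; have := sqr_ge0 (enorm (x - x0)); lra.
  rewrite ord1; apply: le_trans (coord_le_enorm _ _) _.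
  have := ler_enormD (x - x0) x0; rewrite subrK.
  have := sqr_ge0 (enorm (x - x0)); have := sqr_ge0 (enorm (x - x0) - 1).
  rewrite !expr2 in xrho *; lra.
have ball_x0 rho : 0 <= rho -> ball rho x0.
  by move=> ?; rewrite /ball /= subrr enorm_sqr dot0r.
have [p1 p1_ball p1_min] := lower_semicontinuous_min f_lsc (ball_compact 1)
  (ex_intro _ x0 (ball_x0 1 ler01)).
have fin x : (f x < +oo)%E -> f x \is a fin_num.
  by move=> fx; rewrite fin_numElt f_ninfty.
pose a0 := fine (f x0); have fx0E : f x0 = a0%:E by rewrite fineK ?fin.
have fp1_fin : f p1 \is a fin_num.
  by apply: fin; apply: le_lt_trans fx0; apply: p1_min; exact: ball_x0.
pose m := fine (f p1); have fp1E : f p1 = m%:E by rewrite fineK.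
have ma0 : m <= a0 by rewrite -lee_fin -fp1E -fx0E; apply: p1_min; exact: ball_x0.
pose D := enorm (x0 - z); have D0 : 0 <= D := enorm_ge0 _.
(* Convexity along the ray from [x0] gives [f x >= a0 - |x - x0| (a0 - m)] off
   the unit ball, and the quadratic term wins beyond radius [rho0]. *)
pose rho0 := 1 + 2 * D + 2 * (a0 - m) / c.
have rho0_ge1 : 1 <= rho0.
  have : 0 <= 2 * (a0 - m) / c by rewrite divr_ge0 ?(ltW c0)// mulr_ge0// subr_ge0.
  rewrite /rho0; lra.
have obj_lsc : lower_semicontinuous (prox_objective c f z).
  have -> : prox_objective c f z =
      (fun x => (c / 2 * enorm (x - z) ^+ 2)%:E + f x)%E.
    by apply/funext => x; rewrite /prox_objective addeC.
  apply: lower_semicontinuousD => //; apply: continuous_lower_semicontinuous.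
  have xz x : (enorm (y - z) ^+ 2 : R) @[y --> x] --> enorm (x - z) ^+ 2.
    exact: continuous_enorm_sqr.
  by move=> x; exact: (cvgM (cvg_cst (c / 2)) (xz x)).
have [p _ p_min] := lower_semicontinuous_min obj_lsc (ball_compact (rho0 ^+ 2))
  (ex_intro _ x0 (ball_x0 _ (sqr_ge0 _))).
exists p => x; have [/p_min//|/negP] := pselect (ball (rho0 ^+ 2) x).
rewrite /ball /= -ltNge ltr_sqr ?nnegrE ?enorm_ge0//; last lra.
set rho := enorm (x - x0) => rho_gt.
apply: le_trans (p_min x0 (ball_x0 _ (sqr_ge0 _))) _.
have [fx|] := ltP (f x) +oo%E; last first.
  by rewrite leye_eq /prox_objective => /eqP ->; rewrite leey.
have := fin _ fx => /fineK; set b := fine _ => fxE.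
rewrite /prox_objective fx0E -fxE -!EFinD lee_fin.
have rho_gt0 : 0 < rho by lra.
have rho01 : 0 <= rho^-1 <= 1.
  by rewrite invr_ge0 (ltW rho_gt0) invf_le1//=; lra.
(* The segment from [x0] to [x] meets the unit sphere around [x0] here, so [m] bounds the value of
   [f] from below. *)
have y_ball : ball 1 (rho^-1 *: x + (1 - rho^-1) *: x0).
  rewrite /ball /= [X in enorm X](_ : _ = rho^-1 *: (x - x0)).
    by rewrite enormZ -/rho gtr0_norm ?invr_gt0// mulVf ?expr1n// gt_eqF.
  by rewrite scalerBl scale1r scalerBr; apply/rowP => i; rewrite !mxE; ring.
have := p1_min _ y_ball; rewrite fp1E => /le_trans.
have fxb : (f x <= b%:E)%E by rewrite fxE.
have fx0a : (f x0 <= a0%:E)%E by rewrite fx0E.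
move=> /(_ _ (f_convex _ _ _ _ _ rho01 fxb fx0a)); rewrite lee_fin.
rewrite -(ler_pM2l rho_gt0).
rewrite [X in _ <= X](_ : _ = b + (rho - 1) * a0); last by field; rewrite gt_eqF.
move=> Hm.
have xzE : x - z = x - x0 + (x0 - z) by rewrite addrA subrK.
rewrite xzE (enormDsqr (x - x0)) -/rho -/D.
have := Cauchy_Schwarz (- (x - x0)) (x0 - z).
rewrite enormN -/rho -/D dotNl => CS.
have CS' : 0 <= c * (rho * D + dot (x - x0) (x0 - z)).
  by rewrite mulr_ge0 ?(ltW c0)//; lra.
(* By [Hm] and Cauchy-Schwarz it remains to see that [rho * (c * rho / 2 - c * D - (a0 - m))] is
   nonnegative, which the choice of [rho0] ensures. *)
have : 0 <= c * (rho - rho0) * rho.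
  by rewrite !mulr_ge0 ?(ltW rho_gt0) ?(ltW c0)// subr_ge0 ltW.
rewrite /rho0 (_ : c * (rho - (1 + 2 * D + 2 * (a0 - m) / c)) =
  c * rho - c - 2 * c * D - 2 * (a0 - m)); last by field; rewrite gt_eqF.
have : 0 <= c * rho by rewrite mulr_ge0 ?(ltW c0) ?(ltW rho_gt0).
have : 0 <= a0 - m by rewrite subr_ge0.
rewrite !expr2; lra.
Qed.

(** First-order optimality: compare [p] with [p + t (y - p)], apply convexity and divide by [t]; the
    remaining error is [c / 2 * t * Q]. *)
Lemma prox_subgradient c f z p : 0 < c ->
  epi_convex f -> proper_function f ->
  (forall x, (prox_objective c f z p <= prox_objective c f z x)%E) ->
  subdifferential f p (c *: (z - p)).
Proof.
move=> c0 f_convex [f_ninfty [x0 fx0]] p_min.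
have fin x : (f x < +oo)%E -> f x \is a fin_num.
  by move=> fx; rewrite fin_numElt f_ninfty.
have /fin/fineK : (f p < +oo)%E.
  have := p_min x0; rewrite /prox_objective -(fineK (fin _ fx0)).
  by case: (f p) => // r; rewrite ltry.
set a := fine _ => fpE y.
have [fy|] := ltP (f y) +oo%E; last first.
  by rewrite leye_eq => /eqP ->; exact: leey.
have := fin _ fy => /fineK; set b := fine _ => fyE.
rewrite -fpE -fyE -EFinD lee_fin dotZl.
pose Q := enorm (y - p) ^+ 2; have Q0 : 0 <= Q := sqr_ge0 _.
pose e := b - a - c * dot (z - p) (y - p).
suff : 0 <= e by rewrite /e; lra.
have small t : 0 < t -> t <= 1 -> 0 <= e + c / 2 * t * Q.
  move=> t0 t1; have t01 : 0 <= t <= 1 by rewrite ltW.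
  have fyb : (f y <= b%:E)%E by rewrite fyE.
  have fpa : (f p <= a%:E)%E by rewrite fpE.
  have := f_convex t y p b a t01 fyb fpa.
  have := p_min (t *: y + (1 - t) *: p); rewrite /prox_objective -fpE => H1 H2.
  have := le_trans H1 (leeD2r _ H2); rewrite -!EFinD lee_fin.
  have -> : t *: y + (1 - t) *: p - z = (p - z) + t *: (y - p).
    by apply/rowP => i; rewrite !mxE; ring.
  rewrite (enormDsqr (p - z)) enormZ (gtr0_norm t0) exprMn -/Q.
  rewrite -(opprB z p) enormN dotNl dotZr => H3.
  rewrite -(pmulr_rge0 _ t0) /e; move: H3; rewrite !expr2; lra.
rewrite leNgt; apply/negP => e0.
have cQ : 0 <= c * Q by rewrite mulr_ge0// ltW.
have den0 : 0 < c * Q - e by lra.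
(* An explicit [t] in place of a limit: for [e < 0] it lies in []0, 1]] and makes
   [e + c / 2 * t * Q] negative. *)
have := small (- e / (c * Q - e)); rewrite divr_gt0 ?oppr_gt0//.
rewrite ler_pdivrMr// mul1r => /(_ isT) H.
have {H} : 0 <= e + c / 2 * (- e / (c * Q - e)) * Q by apply: H; lra.
rewrite -(pmulr_rge0 _ den0).
rewrite (_ : _ * _ = e * (c * Q / 2 - e)); last by field; rewrite gt_eqF.
by nra.
Qed.

End ConvexAnalysis.

(** * Gradients versus subgradients *)

Section Gradients.
Context {R : realType} {n : nat}.
Implicit Types (x e u s : 'rV[R]_n) (f g r : 'rV[R]_n -> R).

(** The difference quotients at [d / 2] and [- (d / 2)] lie on opposite sides of [c], yet both are
    within half of the gap between [D] and [c] from [D]. *)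
Lemma derive_supporting_line f x e (c : R) : derivable f x e ->
  (forall t : R, f x + t * c <= f (x + t *: e)) -> 'D_e f x = c.
Proof.
move=> f_der f_ge; apply/eqP/negPn/negP => Dc.
set D := 'D_e f x in Dc.
have eps0 : 0 < `|D - c| / 2 by rewrite divr_gt0// normr_gt0 subr_eq0.
have /nbhs_ballP[d /= d0 Hd] : \forall t \near (0 : R), t != 0 ->
    `|D - t^-1 * (f (t *: e + x) - f x)| < `|D - c| / 2.
  exact: (@cvgr_dist_lt _ _ _ _ _ _ _ f_der _ eps0).
have Ht t : t != 0 -> `|t| < d ->
    `|D - t^-1 * (f (x + t *: e) - f x)| < `|D - c| / 2.
  move=> t0 td; have := Hd t; rewrite /= /ball/= sub0r normrN => /(_ td t0).
  by rewrite (addrC x).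
have d20 : 0 < d / 2 by rewrite divr_gt0.
have := Ht (d / 2); rewrite gt_eqF// gtr0_norm// => /(_ isT).
rewrite ltr_pdivrMr// ltr_pMr// ltr1n => /(_ isT).
have := Ht (- (d / 2)); rewrite oppr_eq0 gt_eqF// normrN gtr0_norm// => /(_ isT).
rewrite ltr_pdivrMr// ltr_pMr// ltr1n => /(_ isT).
set q1 := _^-1 * _; set q2 := _^-1 * _.
have q1c : q1 <= c.
  by rewrite /q1 invrN mulNr lerNl ler_pdivlMl//; have := f_ge (- (d / 2)); lra.
have q2c : c <= q2 by rewrite /q2 ler_pdivlMl//; have := f_ge (d / 2); lra.
by case: (ltrP (D - c) 0) => Dc0; rewrite ?(ltr0_norm Dc0) ?(ger0_norm Dc0);
  rewrite !ltr_norml; lra.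
Qed.

(** The remainder of [g] lies between 0 and that of [f], which is [o(t)], so the difference
    quotients of [g] converge to [c]. *)
Lemma derive_squeeze f g x e (D c : R) : is_derive x e f D ->
  (forall t : R, 0 <= g (x + t *: e) - g x - t * c <= f (x + t *: e) - f x - t * D) ->
  'D_e g x = c.
Proof.
move=> [f_der fD] fg; apply: cvg_lim => //; apply/cvgrPdist_lt => eps eps0.
have : \forall t \near (0 : R)^', `|D - t^-1 *: (f (t *: e + x) - f x)| < eps.
  by rewrite -fD; exact: (@cvgr_dist_lt _ _ _ _ _ _ _ f_der _ eps0).
apply: filterS2 (nbhs_dnbhs_neq (0 : R)) => t t0 /=.
apply: le_lt_trans; rewrite (addrC (t *: e)).
have quotient (h : 'rV[R]_n -> R) (b : R) :
    `|b - t^-1 *: (h (x + t *: e) - h x)| =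
    `|t|^-1 * `|h (x + t *: e) - h x - t * b|.
  rewrite -normfV -normrM distrC mulrBr mulKf//.
rewrite !quotient ler_wpM2l ?invr_ge0// ger0_norm ?ger0_norm; have := fg t; lra.
Qed.

Lemma subgradient_gradient f x s : differentiable f x ->
  subdifferential (EFin \o f) x s -> s = gradient f x.
Proof.
move=> f_diff xs; apply/rowP => i; rewrite mxE; apply/esym.
apply: derive_supporting_line => [|t]; first exact: diff_derivable.
have := xs (x + t *: delta_mx 0 i).
by rewrite /= -EFinD lee_fin addrAC subrr add0r dotZr dot_delta.
Qed.

(* The remainders of [g] and [r] with respect to any of their subgradients are
   nonnegative and add up to that of [g + r], so both are [o(t)]. *)
Lemma gradientD_convex g r x :
  epi_convex (EFin \o g) -> epi_convex (EFin \o r) ->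
  differentiable (fun y => g y + r y) x ->
  gradient g x + gradient r x = gradient (fun y => g y + r y) x.
Proof.
move=> g_convex r_convex gr_diff.
have [u xu] := subgradient_exists x g_convex.
have [v xv] := subgradient_exists x r_convex.
have xuv : subdifferential (EFin \o (fun y => g y + r y)) x (u + v).
  move=> y; have := xu y; have := xv y; rewrite /= -!EFinD !lee_fin dotDl; lra.
have uvE := subgradient_gradient gr_diff xuv.
rewrite -uvE; apply/rowP => i; rewrite !mxE.
have gr_der : is_derive x (delta_mx 0 i) (fun y => g y + r y) (u 0 i + v 0 i).
  have -> : u 0 i + v 0 i = gradient (fun y => g y + r y) x 0 i by rewrite -uvE mxE.
  by rewrite mxE; apply: derivableP; exact: diff_derivable.
congr (_ + _); apply: (derive_squeeze gr_der) => t.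
all: have := xu (x + t *: delta_mx 0 i); have := xv (x + t *: delta_mx 0 i).
all: rewrite /= -!EFinD !lee_fin (addrAC x) subrr add0r !dotZr !dot_delta; lra.
Qed.

End Gradients.

(** * From second moments to rates in expectation *)

Section Expectations.
Local Open Scope ereal_scope.
Context {d : measure_display} {T : measurableType d} {R : realType}.

(* No measurability is needed, the integral of a nonnegative function being a
   supremum over the simple functions below it. *)
Lemma ge0_le_integral_nonmeasurable (mu : {measure set T -> \bar R})
    (f1 f2 : T -> \bar R) :
  (forall x, 0 <= f1 x) -> (forall x, f1 x <= f2 x) ->
  \int[mu]_x f1 x <= \int[mu]_x f2 x.
Proof.
move=> f1_ge0 f12; rewrite !ge0_integralTE//; last first.
  by move=> x; exact: le_trans (f12 x).
apply: le_ereal_sup => _ [h /= hf1 <-]; exists h => // x.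
exact: le_trans (f12 x).
Qed.

(** With [y = k * s ^+ 2], the claim is that [y] to the power [nu / 2] is at most [1 + y]: the power
    is at most 1 if [y <= 1], and at most [y] otherwise. *)
Lemma powR_le_affine (s k nu : R) : (0 <= s)%R -> (0 < k)%R -> (0 < nu <= 1)%R ->
  (s `^ nu <= (k `^ (nu / 2))^-1 * (1 + k * s ^+ 2))%R.
Proof.
move=> s_ge0 k_gt0 /andP[nu_gt0 nu_le1].
have ks_ge0 : (0 <= k * s ^+ 2)%R by rewrite mulr_ge0 ?sqr_ge0 ?ltW.
rewrite ler_pdivlMl ?powR_gt0//.
have -> : (k `^ (nu / 2) * s `^ nu = (k * s ^+ 2) `^ (nu / 2))%R.
  rewrite powRM ?sqr_ge0 ?ltW// -powR_mulrn// -powRrM.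
  by congr (_ * _ `^ _)%R; field.
have [ks1|ks1] := leP (k * s ^+ 2)%R 1%R.
  rewrite (@le_trans _ _ 1%R) ?lerDl//.
  apply: (@le_trans _ _ (1 `^ (nu / 2))%R); last by rewrite powR1.
  by rewrite ge0_ler_powR ?nnegrE//; lra.
rewrite (@le_trans _ _ (k * s ^+ 2)%R) ?lerDr//.
by rewrite -[leRHS]powRr1// ler_powR ?(ltW ks1)//; lra.
Qed.

(** The weight [k] matches the moment bound [C / k], so that [1 + k * s ^+ 2] has integral at most
    [1 + C]. The linear term is handled as the power with exponent 1. *)
Lemma integral_powR_le (P : probability T R) (s : T -> R) (k nu A B C : R)
    (f : T -> \bar R) :
  measurable_fun setT s -> (forall w, (0 <= s w)%R) ->
  (0 < k)%R -> (0 < nu <= 1)%R -> (0 <= A)%R -> (0 <= B)%R ->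
  'E_P[fun w => (s w ^+ 2)%R] <= (C * k^-1)%:E ->
  (forall w, 0 <= f w) -> (forall w, f w <= (A * s w `^ nu + B * s w)%:E) ->
  \int[P]_w f w <=
    ((1 + C) * (A * (k `^ (nu / 2))^-1 + B * (k `^ (1 / 2))^-1))%:E.
Proof.
move=> s_meas s_ge0 k_gt0 nu01 A_ge0 B_ge0; rewrite unlock => sC f_ge0 fAB.
set c := (A * _ + _)%R.
have c_ge0 : (0 <= c)%R.
  by rewrite addr_ge0// mulr_ge0// invr_ge0 powR_ge0.
have s2_ge0 w : (0 <= 1 + k * s w ^+ 2)%R.
  by rewrite addr_ge0// mulr_ge0 ?(ltW k_gt0)// sqr_ge0.
apply: (@le_trans _ _ (\int[P]_w (c * (1 + k * s w ^+ 2))%:E)).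
  apply: ge0_le_integral_nonmeasurable => // w.
  apply: (le_trans (fAB w)); rewrite lee_fin /c mulrDl -!mulrA.
  apply: lerD; rewrite ler_wpM2l//; first exact: powR_le_affine.
  by rewrite -[leLHS]powRr1//; apply: powR_le_affine; rewrite ?ltr01 ?lexx.
under eq_integral => w _ do
  rewrite (EFinM c) [(1 + _)%:E]EFinD (EFinM k).
have s2_meas : measurable_fun setT (fun w => (s w ^+ 2)%:E).
  by apply/measurable_EFinP; exact: measurable_funX.
rewrite ge0_integralZl//; last 2 first.
- by apply: emeasurable_funD => //; exact: measurable_funeM.
- by move=> w _; rewrite -EFinM -EFinD lee_fin.
rewrite ge0_integralD//; last 2 first.
- by move=> w _; rewrite -EFinM lee_fin mulr_ge0 ?(ltW k_gt0)// sqr_ge0.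
- exact: measurable_funeM.
rewrite integral_cst// mul1e [X in X + _]probability_setT ge0_integralZl//; last 2 first.
- by move=> w _; rewrite lee_fin sqr_ge0.
- by rewrite lee_fin (ltW k_gt0).
rewrite mulrC EFinM lee_wpmul2l// EFinD leeD2l//.
apply: (@le_trans _ _ (k%:E * (C * k^-1)%:E)).
  by apply: lee_wpmul2l; rewrite ?lee_fin ?(ltW k_gt0).
by rewrite -EFinM lee_fin mulrCA mulfV ?mulr1// gt_eqF.
Qed.

End Expectations.

Section Stages.
Context {R : realType}.

(** All three rates of the theorem are instances, with [s] the norm of [Ggamma] at the returned
    point. Taking [k = K] leaves the constant [(1 + C) * (A + B)], free of [K]. *)
Lemma bigO_stages_powR (disp : nat -> measure_display)
    (Omega : forall K, measurableType (disp K))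
    (P : forall K, probability (Omega K) R)
    (s : forall K, Omega K -> R) (f : forall K, Omega K -> \bar R)
    (nu A B : R) (b : nat -> R) :
  (forall K, (0 < K)%N -> measurable_fun setT (s K)) ->
  (forall K w, 0 <= s K w) ->
  bigO_stages (fun K => 'E_(P K)[fun w => (s K w ^+ 2)%R])%E (fun K => K%:R^-1) ->
  0 < nu <= 1 -> 0 <= A -> 0 <= B ->
  (forall K w, (0 <= f K w)%E) ->
  (forall K w, (f K w <= (A * s K w `^ nu + B * s K w)%:E)%E) ->
  (forall K, A * (K%:R `^ (nu / 2))^-1 + B * (K%:R `^ (1 / 2))^-1 <=
     (A + B) * b K) ->
  bigO_stages (fun K => \int[P K]_w f K w)%E b.
Proof.
move=> s_meas s_ge0 [C sC] nu01 A_ge0 B_ge0 f_ge0 fAB ABb.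
(* At [K = 1], [C] bounds a nonnegative expectation. *)
have C_ge0 : 0 <= C.
  have := sC 1%N isT; rewrite invr1 mulr1 -lee_fin; apply: le_trans.
  by apply: expectation_ge0 => w; exact: sqr_ge0.
exists ((1 + C) * (A + B)) => K K_gt0.
have K_gt0' : 0 < K%:R :> R by rewrite ltr0n.
apply: le_trans (integral_powR_le (s_meas K K_gt0) (s_ge0 K) K_gt0' nu01 A_ge0
  B_ge0 (sC K K_gt0) (f_ge0 K) (fAB K)) _.
by rewrite lee_fin -mulrA ler_wpM2l// addr_ge0.
Qed.

End Stages.

(** * The proximal map and its optimality condition *)

Section ProximalPoint.
Context {R : realType} {n : nat}.
Variables (g : 'rV[R]_n -> R) (r : 'rV[R]_n -> \bar R) (h : 'rV[R]_n -> R).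
Variables (dh : 'rV[R]_n -> 'rV[R]_n) (gamma : R).
Implicit Types (x z s : 'rV[R]_n).

Lemma set_dist_ge0 (S T : set 'rV[R]_n) : (0 <= set_dist S T)%E.
Proof.
by apply: le_ereal_inf_tmp => _ [a _ [b _ <-]]; rewrite lee_fin enorm_ge0.
Qed.

Lemma set_dist_le (S T : set 'rV[R]_n) a b : S a -> T b ->
  (set_dist S T <= (enorm (a - b))%:E)%E.
Proof. by move=> Sa Tb; apply: ereal_inf_lbound; exists a => //; exists b. Qed.

Hypothesis gamma_gt0 : 0 < gamma.

(* Completing the square turns the linearization of [h] into a shift of the
   center of the proximal term. *)
Lemma Fgamma_prox z x : (forall y, (-oo < r y)%E) ->
  Fgamma g r h dh gamma z x =
  (prox_objective gamma (fun y => (g y)%:E + r y)%E (z + gamma^-1 *: dh z) x +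
   (- h z - (2 * gamma)^-1 * enorm (dh z) ^+ 2)%:E)%E.
Proof.
move=> r_ninfty; rewrite /Fgamma /prox_objective.
have -> : x - (z + gamma^-1 *: dh z) = (x - z) + - (gamma^-1 *: dh z).
  by rewrite opprD addrA.
rewrite (enormDsqr (x - z)) enormN enormZ dotNr dotZr (dotC (x - z)) exprMn.
rewrite real_normK ?num_real//.
case: (r x) (r_ninfty x) => [b _|_|//]; last by rewrite !addye.
rewrite -!EFinD; congr _%:E; field; exact: lt0r_neq0.
Qed.

Hypotheses (g_lsc : lower_semicontinuous (EFin \o g))
  (g_convex : convex_function setT g) (r_proper : proper_function r)
  (r_lsc : lower_semicontinuous r) (r_convex : convex_ereal r).

(** [Fgamma] is a proximal objective up to a finite constant, so a minimizer exists, [xget] returns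
    one instead of its default, and first-order optimality applies to it. *)
Lemma Pgamma_subgradient z : let p := Pgamma g r h dh gamma z in
  subdifferential (fun y => (g y)%:E + r y)%E p (dh z + gamma *: (z - p)).
Proof.
move=> p; pose f y := ((g y)%:E + r y)%E.
have r_ninfty := r_proper.1.
have f_convex : epi_convex f.
  by apply: epi_convexD; [exact: convex_function_epi|exact: convex_ereal_epi].
have f_proper : proper_function f.
  split=> [y|]; first by rewrite /f; case: (r y) (r_ninfty y) => //= *; rewrite ?ltNyr.
  have [y ry] := r_proper.2; exists y; move: ry; rewrite /f /dom /=.
  by case: (r y) => //= *; rewrite ?ltry.
have f_lsc : lower_semicontinuous f by exact: lower_semicontinuousD.
have [q q_min] := prox_exists (z + gamma^-1 *: dh z) gamma_gt0 f_convex f_lsc f_proper.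
have /xgetPex p_min : exists q, forall x,
    (Fgamma g r h dh gamma z q <= Fgamma g r h dh gamma z x)%E.
  by exists q => x; rewrite !Fgamma_prox//; exact/leeD2r/q_min.
have -> : dh z + gamma *: (z - p) = gamma *: (z + gamma^-1 *: dh z - p).
  by apply/rowP => i; rewrite !mxE; field; exact: lt0r_neq0.
apply: prox_subgradient => // x.
by have := p_min 0 x; rewrite !Fgamma_prox// leeD2rE.
Qed.

Lemma enorm_sub_Pgamma z :
  enorm (z - Pgamma g r h dh gamma z) = gamma^-1 * enorm (Ggamma g r h dh gamma z).
Proof. by rewrite /Ggamma enormZ gtr0_norm// mulKf// gt_eqF. Qed.

End ProximalPoint.

(** * Convergence rates at the returned point *)

Theorem theorem6 (R : realType) (n : nat)
  (g : 'rV[R]_n -> R) (r : 'rV[R]_n -> \bar R) (h : 'rV[R]_n -> R)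
  (g_lsc : lower_semicontinuous (EFin \o g)) (g_convex : convex_function setT g)
  (h_lsc : lower_semicontinuous (EFin \o h)) (h_convex : convex_function setT h)
  (r_proper : proper_function r) (r_lsc : lower_semicontinuous r)
  (r_convex : convex_ereal r)
  (dh : 'rV[R]_n -> 'rV[R]_n)
  (dh_subgradient : forall z, subdifferential (EFin \o h) z (dh z))
  (gamma : R) (gamma_gt0 : 0 < gamma)
  (disp : nat -> measure_display)
  (Omega : forall K, measurableType (disp K))
  (P : forall K, probability (Omega K) R)
  (alg : forall K, nat -> ('rV[R]_n -> \bar R) -> Omega K -> 'rV[R]_n)
  (x : forall K, nat -> Omega K -> 'rV[R]_n)
  (tau : forall K, Omega K -> nat)
  (run : forall K, (0 < K)%N ->
    stagewise_run r (Fgamma g r h dh gamma) K (@alg K) (@x K) (@tau K)) :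
  let xtau K (w : Omega K) := x K (tau K w) w in
  let G := Ggamma g r h dh gamma in
  let ztau K (w : Omega K) := Pgamma g r h dh gamma (xtau K w) in
  (forall K, (0 < K)%N -> measurable_fun setT (fun w => enorm (G (xtau K w)))) ->
  bigO_stages (fun K => 'E_(P K)[fun w => (enorm (G (xtau K w)) ^+ 2)%R])%E
              (fun K => K%:R^-1) ->
  (forall L nu : R, 0 < nu <= 1 ->
     (forall y, r y \is a fin_num) ->
     hoelder_gradient L nu (fun y => g y + fine (r y)) ->
     bigO_stages
       (fun K => \int[P K]_w set_dist (subdifferential (EFin \o h) (xtau K w))
          [set (gradient g (xtau K w) + gradient (fine \o r) (xtau K w))%R])%E
       (fun K => (K%:R `^ (nu / 2))^-1 + (K%:R `^ (1 / 2))^-1))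
  /\
  (forall L nu : R, 0 < nu <= 1 ->
     hoelder_gradient L nu h ->
     bigO_stages (fun K => 'E_(P K)[fun w => enorm (xtau K w - ztau K w)%R])%E
                 (fun K => (K%:R `^ (1 / 2))^-1)
     /\
     bigO_stages
       (fun K => \int[P K]_w set_dist [set gradient h (ztau K w)]
          (minkowski_sum (subdifferential (EFin \o g) (ztau K w))
                         (subdifferential r (ztau K w))))%E
       (fun K => (K%:R `^ (nu / 2))^-1 + (K%:R `^ (1 / 2))^-1)).
Proof.
move=> xtau G ztau G_meas G_bound.
have G_ge0 K w : 0 <= enorm (G (xtau K w)) := enorm_ge0 _.
have xz_enorm K w : enorm (xtau K w - ztau K w) = gamma^-1 * enorm (G (xtau K w)).
  exact: enorm_sub_Pgamma.
have ztau_subgradient K w := Pgamma_subgradient h dh gamma_gt0 g_lsc g_convex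
  r_proper r_lsc r_convex (xtau K w).
(* Used with [f] equal to [g + r] in part (1) and to [h] in part (2). The absolute value of [L]
   keeps the coefficient nonnegative. *)
have hoelder_bound L nu f K w : hoelder_gradient L nu f ->
    enorm (gradient f (ztau K w) - gradient f (xtau K w)) + enorm (G (xtau K w)) <=
    `|L| * gamma^-1 `^ nu * enorm (G (xtau K w)) `^ nu + 1 * enorm (G (xtau K w)).
  move=> [_ fL]; rewrite mul1r lerD2r; apply: (le_trans (fL _ _)).
  rewrite enormB xz_enorm powRM ?invr_ge0 ?(ltW gamma_gt0)// mulrA.
  by rewrite ler_wpM2r ?powR_ge0// ler_wpM2r ?powR_ge0// ler_norm.
have rate A B (nu : R) K : 0 <= A -> 0 <= B ->
    A * (K%:R `^ (nu / 2))^-1 + B * (K%:R `^ (1 / 2))^-1 <=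
    (A + B) * ((K%:R `^ (nu / 2))^-1 + (K%:R `^ (1 / 2))^-1).
  move=> A_ge0 B_ge0; rewrite mulrDl; apply: lerD; apply: ler_wpM2l => //.
    by rewrite lerDl invr_ge0 powR_ge0.
  by rewrite lerDr invr_ge0 powR_ge0.
have coef_ge0 (L nu : R) : 0 <= `|L| * gamma^-1 `^ nu.
  by rewrite mulr_ge0 ?powR_ge0.
split=> [L nu nu01 r_fin gr_hoelder|L nu nu01 h_hoelder].
  have rE : EFin \o (fine \o r) = r by apply/funext => y /=; rewrite fineK.
  have r_epi := convex_ereal_epi r_convex.
  have g_epi := convex_function_epi g_convex.
  apply: (bigO_stages_powR G_meas G_ge0 G_bound nu01 (coef_ge0 L nu) ler01) => [K w|K w|K].
  - exact: set_dist_ge0.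
  - apply: le_trans (set_dist_le (dh_subgradient _) erefl) _.
    rewrite lee_fin (le_trans _ (hoelder_bound _ _ _ K w gr_hoelder))//.
    rewrite gradientD_convex ?rE//; last exact: gr_hoelder.1.
    (* By differentiability, the subgradient from the optimality condition can only be the gradient
       at the proximal point. *)
    have -> : gradient (fun y => g y + fine (r y)) (ztau K w) =
        dh (xtau K w) + G (xtau K w).
      apply/esym/subgradient_gradient; first exact: gr_hoelder.1.
      rewrite (_ : EFin \o _ = fun y => ((g y)%:E + r y)%E); first exact: ztau_subgradient.
      by apply/funext => y /=; rewrite EFinD fineK.
    rewrite -[enorm (G _)]enormN -[in leLHS](addrK (G (xtau K w)) (dh _)).
    by rewrite addrAC ler_enormD.
  - by apply: rate.
split.
  (* The expected distance becomes an instance with [A = 0] once it is written as an extended-real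
     integral. *)
  rewrite (_ : (fun K => _) = fun K => \int[P K]_w (enorm (xtau K w - ztau K w))%:E)%E.
    apply: (bigO_stages_powR (nu := 1) (A := 0) (B := gamma^-1) G_meas G_ge0 G_bound) => //.
    - by rewrite ltr01 lexx.
    - by rewrite invr_ge0 ltW.
    - by move=> K w; rewrite lee_fin enorm_ge0.
    - by move=> K w; rewrite lee_fin mul0r add0r xz_enorm.
    - by move=> K; rewrite mul0r !add0r.
  by apply/funext => K; rewrite unlock.
have h_gradient y : dh y = gradient h y.
  by apply: subgradient_gradient (dh_subgradient y); exact: h_hoelder.1.
apply: (bigO_stages_powR G_meas G_ge0 G_bound nu01 (coef_ge0 L nu) ler01) => [K w|K w|K].
- exact: set_dist_ge0.
(* The sum rule supplies a point of the second set; its distance to [gradient h (ztau K w)] is split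
   at [gradient h (xtau K w)]. *)
- have zs := subgradient_sum (convex_function_epi g_convex)
    (convex_ereal_epi r_convex) r_proper (ztau_subgradient K w).
  apply: le_trans (set_dist_le erefl zs) _.
  rewrite lee_fin (le_trans _ (hoelder_bound _ _ _ K w h_hoelder))//.
  rewrite -[enorm (G _)]enormN h_gradient opprD addrA.
  exact: ler_enormD.
- by apply: rate.
Qed.
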